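(* Let $(X,\rho,\mathcal{S})$ be an unbounded complete hyperbolic space, let $\theta\in X$, let $\phi$ be an admissible function, let $s\geq1$ and $\psi_s(t)=t^{1/s}$ for $t\in(0,\infty)$, and let $\mathcal{M}$ be the set of all nonexpansive self-mappings of $X$. The set \[ \{f\in\mathcal{M}\colon\omega_f(t)<t\text{ for some }t>0\} \] is $\sigma$-$\phi$-porous in $(\mathcal{M},d_{\theta,\phi})$ and $\sigma$-$\psi_s$-porous in $(\mathcal{M},d_{\theta,s})$. In particular, the set of Rakotch contractions on $X$ is $\sigma$-$\phi$-porous in $(\mathcal{M},d_{\theta,\phi})$ and $\sigma$-$\psi_s$-porous in $(\mathcal{M},d_{\theta,s})$.
   Context: Hyperbolic spaces. A geodesic metric space is a metric space $(X,\rho)$ such that for all $x,y\in X$ there is an isometric embedding $c\colon[0,\rho(x,y)]\to X$ with $c(0)=x$, $c(\rho(x,y))=y$; the image of such a $c$ is a metric segment connecting $x$ and $y$. A hyperbolic space is a triple $(X,\rho,\mathcal{S})$ where $(X,\rho)$ is a geodesic metric space and $\mathcal{S}$ is a family of metric segments such that: (1) for each pair $x,y\in X$, $\mathcal{S}$ contains a unique metric segment connecting $x$ and $y$, denoted $[x,y]$; (2) for all $x,y\in X$ and $z,w\in[x,y]$ we have $[z,w]\subset[x,y]$; (3) $\rho((1-\lambda)x\oplus\lambda y,(1-\lambda)x\oplus\lambda z)\leq\lambda\rho(y,z)$ for all $x,y,z\in X$ and $\lambda\in[0,1]$, where $(1-\lambda)x\oplus\lambda y$ denotes the unique point of $[x,y]$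 at distance $\lambda\rho(x,y)$ from $x$ and $(1-\lambda)\rho(x,y)$ from $y$. We write $\bar{B}(z,r)=\{x\in X\colon\rho(x,z)\leq r\}$. Mappings. A mapping $f\colon X\to X$ is nonexpansive if $\rho(f(x),f(y))\leq\rho(x,y)$ for all $x,y\in X$. Its modulus of continuity is $\omega_f(t)=\sup\{\rho(f(x),f(y))\colon x,y\in X,\ \rho(x,y)\leq t\}$, $t\geq0$. A Rakotch contraction is a mapping $f\colon X\to X$ for which there is a (non-strictly) decreasing function $\varphi_f\colon[0,\infty)\to[0,1]$ with $\varphi_f(t)<1$ for $t>0$ such that $\rho(f(x),f(y))\leq\varphi_f(\rho(x,y))\rho(x,y)$ for all $x,y\in X$. Admissible functions. Let $I$ be $(0,1)$ or $(0,1]$. A function $\phi\colon I\to(0,\infty)$ is called admissible here if it is continuous, strictly increasing and satisfies: (C1) there is an $\eta_\phi\in I$ such that $\phi$ is concave on $(0,\eta_\phi)$ and $\phi(\eta_\phi)\geq\eta_\phi$; (C2) $\lim_{t\to0}\phi(t)=0$ and there is a $t\in I$ with $\phi(t)=1$; (C3) for every $k\in\mathbb{N}$ there is a $C_k>0$ such that $\phi^{-1}(\frac1m)\leq C_k\,\phi^{-1}(\frac1{k+m})$ for all $m\in\mathbb{N}$; (C4) $\sum_{n=1}^\infty n\,\phi^{-1}(\frac1n)$ converges. (Here $\mathbb{N}=\{1,2,\dots\}$.) Metrics. For $f,g\in\mathcal{M}$ put $d_{n,\theta}(f,g)=\sup\{\rho(f(x),g(x))\colon x\in\bar{B}(\theta,n)\}$,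 $d_{\theta,\phi}(f,g)=\sum_{n=1}^\infty\phi^{-1}\left(\frac1n\right)\frac{d_{n,\theta}(f,g)}{1+d_{n,\theta}(f,g)}$ and $d_{\theta,s}(f,g)=\sup_{x\in X}\frac{\rho(f(x),g(x))}{1+\rho(x,\theta)^s}$. Porosity. Let $(M,d)$ be a metric space, $A\subset M$, $x\in A$, $\eta\in(0,\infty]$ and $\varphi\colon(0,\eta)\to(0,\infty)$ increasing. Put $\gamma(x,r,A)=\sup\{s>0\colon\exists x'\in M\text{ with }B_M(x',s)\subset B_M(x,r)\setminus A\}$, where $B_M$ denotes open balls and $\sup\emptyset=-\infty$ (so $A$ is not porous at $x$ if $\gamma(x,r,A)=-\infty$ for arbitrarily small $r$). $A$ is $\varphi$-porous at $x$ if $\liminf_{r\to0}\varphi(\gamma(x,r,A))/r>0$, $\varphi$-porous if it is $\varphi$-porous at each of its points, and $\sigma$-$\varphi$-porous if it is a countable union of $\varphi$-porous sets. *)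

(* Defs.v *)
From HB Require Import structures.
From mathcomp Require Import all_boot all_order all_algebra.
From mathcomp Require Import all_classical all_reals all_analysis.
From mathcomp Require Import ring lra.
Set Implicit Arguments.
Unset Strict Implicit.
Unset Printing Implicit Defensive.
Import Order.TTheory GRing.Theory Num.Theory.
Import numFieldNormedType.Exports.
Local Open Scope classical_set_scope.
Local Open Scope ring_scope.

Section Hyperbolic.
Context {R : realType} {X : metricType R}.

Definition geodesic_path (x y : X) (c : R -> X) : Prop :=
  [/\ {in `[0, mdist x y] &, forall a b, mdist (c a) (c b) = `|a - b|},
      c 0 = x & c (mdist x y) = y].

Definition metric_segment (x y : X) (A : set X) : Prop :=
  exists2 c, geodesic_path x y c & A = c @` `[0, mdist x y].

(* [x,y]; meaningful when S contains exactly one segment connecting x and y *)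
Definition seg (S : set (set X)) (x y : X) : set X :=
  get (fun A => S A /\ metric_segment x y A).

(* (1 - l) x (+) l y *)
Definition seg_comb (S : set (set X)) (l : R) (x y : X) : X :=
  xget x [set z | [/\ seg S x y z, mdist x z = l * mdist x y
                    & mdist z y = (1 - l) * mdist x y]].

Record hyperbolic (S : set (set X)) : Prop := {
  hyperbolic_geodesic : forall x y : X, exists c, geodesic_path x y c;
  hyperbolic_segments : forall A, S A -> exists x y, metric_segment x y A;
  hyperbolic_unique :
    forall x y, exists! A, S A /\ metric_segment x y A;
  hyperbolic_sub :
    forall x y z w, seg S x y z -> seg S x y w -> seg S z w `<=` seg S x y;
  hyperbolic_comb : forall x y z (l : R), 0 <= l <= 1 ->
    mdist (seg_comb S l x y) (seg_comb S l x z) <= l * mdist y z }.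

End Hyperbolic.

(* The library's completeType is restricted to pointed types. *)
Definition complete_metric {R : realType} (X : metricType R) : Prop :=
  forall u : nat -> X, cauchy (u @ \oo) -> exists l : X, u @ \oo --> l.

Definition unbounded_metric {R : realType} (X : metricType R) : Prop :=
  forall r : R, exists x y : X, r < mdist x y.

Section Mappings.
Context {R : realType} {X : metricType R}.
Implicit Type f : X -> X.

Definition nonexpansive f : Prop := forall x y, mdist (f x) (f y) <= mdist x y.

Definition modulus f (t : R) : R :=
  sup [set r | exists x y, mdist x y <= t /\ r = mdist (f x) (f y)].

Definition rakotch f : Prop := exists phi : R -> R,
  [/\ forall t, 0 <= t -> 0 <= phi t <= 1,
      forall t u, 0 <= t -> t <= u -> phi u <= phi t,
      forall t, 0 < t -> phi t < 1
    & forall x y, mdist (f x) (f y) <= phi (mdist x y) * mdist x y].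

End Mappings.

Definition nonexp {R : realType} (X : metricType R) : Type :=
  {f : X -> X | nonexpansive f}.

(* phi : I -> (0, oo) is a total function whose values outside of I are
   irrelevant; its inverse is the library's partial inverse pinv I phi.
   k.+1, m.+1 and n.+1 range over the positive integers. *)
Record admissible {R : realType} (I : set R) (phi : R -> R) : Prop := {
  adm_dom : (I = `]0, 1[%classic) \/ (I = `]0, 1]%classic);
  adm_pos : forall t, I t -> 0 < phi t;
  adm_cont : {within I, continuous phi};
  adm_mono : {in I &, {homo phi : t u / t < u}};
  adm_concave : exists eta, [/\ I eta,
    convex_function (E := R^o) `]0, eta[ (fun t => - phi t) & eta <= phi eta];
  adm_lim0 : phi t @[t --> 0^'+] --> 0;
  adm_one : exists2 t, I t & phi t = 1;
  adm_inv_shift : forall k : nat, exists2 C : R, 0 < C & forall m : nat,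
    pinv I phi m.+1%:R^-1 <= C * pinv I phi (k.+1 + m.+1)%:R^-1;
  adm_inv_summable : cvgn (series (fun n => n.+1%:R * pinv I phi n.+1%:R^-1)) }.

Section Distances.
Context {R : realType} {X : metricType R}.
Implicit Types f g h : nonexp X.

Definition dist_ball (theta : X) (n : nat) f g : R :=
  sup [set mdist (sval f x) (sval g x) | x in [set x | mdist x theta <= n%:R]].

Definition dist_phi (I : set R) (phi : R -> R) (theta : X) f g : R :=
  limn (series (fun n => pinv I phi n.+1%:R^-1 *
    (dist_ball theta n.+1 f g / (1 + dist_ball theta n.+1 f g)))).

Definition dist_s (theta : X) (s : R) f g : R :=
  sup [set mdist (sval f x) (sval g x) / (1 + mdist x theta `^ s) | x in setT].

End Distances.

Section DistanceLemmas.
Context {R : realType}.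

Lemma sup_img_le {T} (D : set T) (u : T -> R) (c : R) : D !=set0 ->
  (forall x, D x -> u x <= c) -> sup (u @` D) <= c.
Proof.
move=> [x0 Dx0] uc; apply: ge_sup; first by exists (u x0), x0.
by move=> _ [x Dx <-]; exact: uc.
Qed.

Lemma le_sup_img {T} (D : set T) (u : T -> R) (c : R) (x : T) :
  (forall x, D x -> u x <= c) -> D x -> u x <= sup (u @` D).
Proof.
move=> uc Dx; apply: ub_le_sup; last by exists x.
by exists c => _ [y Dy <-]; exact: uc.
Qed.

Context {X : metricType R}.
Implicit Types f g h : nonexp X.

Lemma nonexp_eq f g : (forall x, sval f x = sval g x) -> f = g.
Proof. by case: f g => f fP [g gP] fg; apply: eq_exist; exact/funext. Qed.

Lemma mdist_nonexp_le (theta x : X) f g :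
  mdist (sval f x) (sval g x) <=
  2 * mdist x theta + mdist (sval f theta) (sval g theta).
Proof.
have h1 := metric_triangle (sval f x) (sval f theta) (sval g x).
have h2 := metric_triangle (sval f theta) (sval g theta) (sval g x).
have h3 := svalP f x theta; have h4 := svalP g theta x.
rewrite (metric_sym theta x) in h4; lra.
Qed.

Section Ball.
Variables (theta : X) (n : nat).

Let ball_bound f g x : mdist x theta <= n%:R -> mdist (sval f x) (sval g x) <=
  2 * n%:R + mdist (sval f theta) (sval g theta).
Proof. by move=> xn; have := mdist_nonexp_le theta x f g; lra. Qed.

Let ball_neq0 : [set x | mdist x theta <= n%:R] !=set0.
Proof. by exists theta => /=; rewrite mdistxx. Qed.

Lemma dist_ball_ub f g x : mdist x theta <= n%:R ->
  mdist (sval f x) (sval g x) <= dist_ball theta n f g.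
Proof.
move=> xn; apply: (@le_sup_img _ [set x | mdist x theta <= n%:R]
  (fun x => mdist (sval f x) (sval g x))) xn; exact: ball_bound.
Qed.

Lemma dist_ball_ge0 f g : 0 <= dist_ball theta n f g.
Proof.
apply: le_trans (dist_ball_ub f g (x := theta) _); first exact: mdist_ge0.
by rewrite mdistxx.
Qed.

Lemma dist_ballxx f : dist_ball theta n f f = 0.
Proof.
apply/le_anti; rewrite dist_ball_ge0 andbT.
by apply: sup_img_le => // x _; rewrite mdistxx.
Qed.

Lemma dist_ball_sym f g : dist_ball theta n f g = dist_ball theta n g f.
Proof. by congr sup; apply: eq_imagel => x _; exact: metric_sym. Qed.

Lemma dist_ball_triangle g f h :
  dist_ball theta n f h <= dist_ball theta n f g + dist_ball theta n g h.
Proof.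
apply: sup_img_le => // x xn.
apply: le_trans (metric_triangle _ (sval g x) _) _.
by apply: lerD; exact: dist_ball_ub.
Qed.

End Ball.

Section Sup.
Variables (theta : X) (s : R) (s1 : 1 <= s).

Let den_gt0 (x : X) : 0 < 1 + mdist x theta `^ s.
Proof. by rewrite ltr_pwDl// powR_ge0. Qed.

Let le_den (x : X) : mdist x theta <= 1 + mdist x theta `^ s.
Proof.
have [h|h] := leP (mdist x theta) 1.
  by rewrite (le_trans h)// lerDl powR_ge0.
apply: (@le_trans _ _ (mdist x theta `^ s)); last by rewrite lerDr.
by rewrite -[leLHS]powRr1 ?mdist_ge0// ler_powR// ltW.
Qed.

Let s_bound f g (x : X) : setT x ->
  mdist (sval f x) (sval g x) / (1 + mdist x theta `^ s) <=
  2 + mdist (sval f theta) (sval g theta).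
Proof.
move=> _; rewrite ler_pdivrMr//; apply: le_trans (mdist_nonexp_le theta x f g) _.
rewrite [leRHS]mulrDl; apply: lerD; first by rewrite ler_pM2l.
by rewrite ler_peMr ?mdist_ge0// lerDl powR_ge0.
Qed.

Let setT_neq0 : [set: X] !=set0. Proof. by exists theta. Qed.

Lemma dist_s_ub f g (x : X) :
  mdist (sval f x) (sval g x) / (1 + mdist x theta `^ s) <= dist_s theta s f g.
Proof.
apply: (@le_sup_img _ setT
  (fun x => mdist (sval f x) (sval g x) / (1 + mdist x theta `^ s))) => //.
exact: s_bound.
Qed.

Lemma dist_s_ge0 f g : 0 <= dist_s theta s f g.
Proof.
by apply: le_trans (dist_s_ub f g theta); rewrite divr_ge0 ?mdist_ge0// ltW.
Qed.

Lemma dist_sxx f : dist_s theta s f f = 0.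
Proof.
apply/le_anti; rewrite dist_s_ge0 andbT.
by apply: sup_img_le => // x _; rewrite mdistxx mul0r.
Qed.

Lemma dist_s_eq0 f g : dist_s theta s f g = 0 -> f = g.
Proof.
move=> fg0; apply: nonexp_eq => x; apply: mdist_positivity.
apply/le_anti; rewrite mdist_ge0 andbT.
by have := dist_s_ub f g x; rewrite fg0 pmulr_lle0 // invr_gt0.
Qed.

Lemma dist_s_sym f g : dist_s theta s f g = dist_s theta s g f.
Proof. by congr sup; apply: eq_imagel => x _; rewrite metric_sym. Qed.

Lemma dist_s_triangle g f h :
  dist_s theta s f h <= dist_s theta s f g + dist_s theta s g h.
Proof.
apply: sup_img_le => // x _.
apply: le_trans (lerD (dist_s_ub f g x) (dist_s_ub g h x)).
by rewrite -mulrDl ler_pM2r ?invr_gt0//; exact: metric_triangle.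
Qed.

End Sup.

Section Series.
Variables (theta : X) (I : set R) (phi : R -> R) (adm : admissible I phi).

Let I_gt0 t : I t -> 0 < t.
Proof. by case: (adm_dom adm) => ->; rewrite /= in_itv/= => /andP[]. Qed.

Let I_down t u : I u -> 0 < t -> t <= u -> I t.
Proof.
case: (adm_dom adm) => ->; rewrite /= !in_itv/= => /andP[_ u1] -> tu /=.
  exact: le_lt_trans u1.
exact: le_trans u1.
Qed.

Lemma adm_surj (y : R) : 0 < y <= 1 -> exists2 t, I t & phi t = y.
Proof.
move=> /andP[y0 y1]; have [t1 It1 pt1] := adm_one adm.
have t10 := I_gt0 It1.
have [a [a0 at1 ay]] : exists a, [/\ 0 < a, a <= t1 & phi a < y].
  have H : \forall t \near 0^'+, phi t < y.
    by apply: (cvgr_lt 0); [exact: (adm_lim0 adm)|].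
  near (0 : R)^'+ => a; exists a; split.
  - by near: a; exact: nbhs_right_gt.
  - by near: a; exact: nbhs_right_le.
  - by near: a.
have sub : `[a, t1] `<=` I.
  move=> t /=; rewrite in_itv/= => /andP[at_ tt1].
  by apply: I_down tt1 => //; exact: lt_le_trans at_.
have cont : {within `[a, t1], continuous phi}.
  exact: continuous_subspaceW sub (adm_cont adm).
have [||c + cy] := @IVT R phi a t1 y _ cont _ => //.
  by rewrite ge_min le_max pt1 y1 (ltW ay) !orbT.
by move=> cI; exists c => //; exact: sub.
Unshelve. all: by end_near. Qed.

Lemma pinv_adm n : 0 < pinv I phi n.+1%:R^-1.
Proof.
apply: I_gt0; apply: (@surjpinv_image_sub _ _ _ I [set y | 0 < y <= 1] phi).
  by move=> y /adm_surj[t It <-]; exists t.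
exists n.+1%:R^-1 => //=.
by rewrite invr_gt0 ltr0n/= invf_le1 ?ltr0n// ler1n.
Qed.

Let term f g (n : nat) := pinv I phi n.+1%:R^-1 *
  (dist_ball theta n.+1 f g / (1 + dist_ball theta n.+1 f g)).

Let frac_ge0 (t : R) : 0 <= t -> 0 <= t / (1 + t).
Proof. by move=> t0; rewrite divr_ge0// addr_ge0. Qed.

Let frac_le1 (t : R) : 0 <= t -> t / (1 + t) <= 1.
Proof. by move=> t0; rewrite ler_pdivrMr ?mul1r ?lerDr// ltr_pwDl. Qed.

Let frac_sub (t u v : R) : 0 <= t -> 0 <= u -> 0 <= v -> t <= u + v ->
  t / (1 + t) <= u / (1 + u) + v / (1 + v).
Proof.
move=> t0 u0 v0 tuv.
have p (z : R) : 0 <= z -> 0 < 1 + z by move=> z0; rewrite ltr_pwDl.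
have e (z : R) : 0 <= z -> z / (1 + z) = 1 - (1 + z)^-1.
  by move=> z0; have := p _ z0 => z1; field; rewrite gt_eqF.
apply: (@le_trans _ _ ((u + v) / (1 + (u + v)))).
  rewrite !e ?addr_ge0// lerD2l lerN2 lef_pV2 ?posrE ?p ?addr_ge0//.
  by rewrite lerD2l.
rewrite mulrDl; apply: lerD; rewrite ler_wpM2l// lef_pV2 ?posrE ?p ?addr_ge0//; lra.
Qed.

Let term_ge0 f g n : 0 <= term f g n.
Proof. by rewrite mulr_ge0 ?(ltW (pinv_adm _))// frac_ge0 ?dist_ball_ge0. Qed.

Let term_cvg f g : cvgn (series (term f g)).
Proof.
apply: series_le_cvg (adm_inv_summable adm) => // n.
  by rewrite mulr_ge0 ?(ltW (pinv_adm _)).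
rewrite /term [leRHS]mulrC ler_pM2l ?pinv_adm//.
by apply: le_trans (frac_le1 (dist_ball_ge0 _ _ _ _)) _; rewrite ler1n.
Qed.

Lemma dist_phixx f : dist_phi I phi theta f f = 0.
Proof.
rewrite /dist_phi (_ : series _ = fun=> 0) ?lim_cst//.
apply/funext => n; rewrite /series/= big1// => k _.
by rewrite dist_ballxx mul0r mulr0.
Qed.

Lemma dist_phi_eq0 f g : dist_phi I phi theta f g = 0 -> f = g.
Proof.
move=> fg0; apply: nonexp_eq => x; apply: mdist_positivity.
set n := (Num.truncn (mdist x theta)).
have xn : mdist x theta <= n.+1%:R.
  by apply/ltW; exact: truncnS_gt.
apply/le_anti; rewrite mdist_ge0 andbT.
apply: le_trans (dist_ball_ub f g xn) _.
have tn : term f g n <= 0.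
  rewrite -fg0 /dist_phi -/(term f g); apply: (@le_trans _ _ (series (term f g) n.+1)).
    by rewrite /series/= big_nat_recr//= lerDr; exact: sumr_ge0.
  apply: (nondecreasing_cvgn_le _ (term_cvg (f := f) (g := g))).
  by apply/nondecreasing_seqP => k; rewrite /series/= big_nat_recr//= lerDl.
have d0 := dist_ball_ge0 theta n.+1 f g.
move: tn; rewrite /term pmulr_rle0 ?pinv_adm// pmulr_lle0//.
by rewrite invr_gt0 ltr_pwDl.
Qed.

Lemma dist_phi_sym f g : dist_phi I phi theta f g = dist_phi I phi theta g f.
Proof.
by congr (limn (series _)); apply/funext => n; rewrite dist_ball_sym.
Qed.

Lemma dist_phi_triangle g f h : dist_phi I phi theta f h <=
  dist_phi I phi theta f g + dist_phi I phi theta g h.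
Proof.
have sD : series (fun n => term f g n + term g h n) =
    series (term f g) + series (term g h).
  by apply/funext => n; rewrite /series/= big_split.
have -> : dist_phi I phi theta f g + dist_phi I phi theta g h =
    limn (series (fun n => term f g n + term g h n)).
  by rewrite sD limD//; exact: term_cvg.
apply: lim_series_le; first exact: term_cvg.
  by rewrite sD; apply: is_cvgD; exact: term_cvg.
move=> n; rewrite /term -mulrDr ler_pM2l ?pinv_adm//.
by apply: frac_sub; rewrite ?dist_ball_ge0//; exact: dist_ball_triangle.
Qed.

End Series.
End DistanceLemmas.

(* Two copies of nonexp X, to carry the metrics d_{theta,phi} and d_{theta,s};
   the metric depends on the parameters, the carrier does not. *)
Definition nonexp_phi {R : realType} {X : metricType R} (theta : X) (I : set R)
  (phi : R -> R) (adm : admissible I phi) : Type := nonexp X.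

Definition nonexp_s {R : realType} {X : metricType R} (theta : X) (s : R)
  (s1 : 1 <= s) : Type := nonexp X.

Section Instances.
Context {R : realType} {X : metricType R} (theta : X).

Section Phi.
Context (I : set R) (phi : R -> R) (adm : admissible I phi).
HB.instance Definition _ := gen_eqMixin (nonexp_phi theta adm).
HB.instance Definition _ := gen_choiceMixin (nonexp_phi theta adm).
HB.instance Definition _ := isMetric.Build R (nonexp_phi theta adm)
  (dist_phixx theta I phi) (dist_phi_eq0 adm)
  (dist_phi_sym theta I phi) (dist_phi_triangle theta adm).
End Phi.

Section S.
Context (s : R) (s1 : 1 <= s).
HB.instance Definition _ := gen_eqMixin (nonexp_s theta s1).
HB.instance Definition _ := gen_choiceMixin (nonexp_s theta s1).
HB.instance Definition _ := isMetric.Build R (nonexp_s theta s1)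
  (dist_sxx theta s1) (dist_s_eq0 s1)
  (dist_s_sym theta s) (dist_s_triangle theta s1).
End S.

End Instances.

Section Porosity.
Context {R : realType} {M : metricType R}.

(* ball is the library's open ball; ereal_sup set0 = -oo *)
Definition gamma (x : M) (r : R) (A : set M) : \bar R :=
  ereal_sup [set s%:E | s in
    [set s | 0 < s /\ exists x', ball x' s `<=` ball x r `\` A]].

(* For x in A we have gamma x r A <= r, so that only the values of phi near 0
   matter, and phi can be given by a total function. *)
Definition porous_at (phi : R -> R) (A : set M) (x : M) : Prop :=
  (0 < limf_einf (fun r : R => er_map phi (gamma x r A) * r^-1%:E) 0^'+)%E.

Definition porous (phi : R -> R) (A : set M) : Prop :=
  forall x, A x -> porous_at phi A x.

Definition sigma_porous (phi : R -> R) (A : set M) : Prop :=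
  exists F : nat -> set M, (forall i, porous phi (F i)) /\ A = \bigcup_i F i.

End Porosity.

Arguments sigma_porous {R} M phi A.

(* Main.v *)
(* Every f with omega_f(t) < t for some t > 0 lies, for some rationals t' < t,
   in the set of maps sending pairs at distance at most t to pairs at distance
   at most t', and every subset of such a set is porous.  Given f and a small
   e > 0, there is a nonexpansive g with d(f x, g x) <= 3 e d(x, theta) for all
   x which preserves the distance of two points p, q with d(p, q) = t, both
   within 3 t / e of theta.  Both metrics are controlled by
   sup_x d(f x, g x) / d(x, theta), so g is at distance O(e) from f, and no map
   that is uniformly close to g on the ball of radius 3 t / e is in the set.  In
   d_{theta,s} this excludes a ball of radius of order e^s; in d_{theta,phi} one
   of radius of order phi^-1(1/n) with n of order 1/e, and concavity of phi near
   0 makes phi of this radius at least of order e. *)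
Require Import Defs.
From HB Require Import structures.
From mathcomp Require Import all_boot all_order all_algebra.
From mathcomp Require Import all_classical all_reals all_analysis.
From mathcomp Require Import ring lra.
Set Implicit Arguments.
Unset Strict Implicit.
Unset Printing Implicit Defensive.
Import Order.TTheory GRing.Theory Num.Theory.
Import numFieldNormedType.Exports.
Local Open Scope classical_set_scope.
Local Open Scope ring_scope.

(** * Geodesics, convex combinations, and pulling points towards a centre *)

Section Geometry.
Context {R : realType} {X : metricType R} (S : set (set X)).
Hypothesis hypX : hyperbolic S.
Implicit Types x y z : X.

Lemma geodesic_dist x y c a b : geodesic_path x y c ->
  0 <= a <= mdist x y -> 0 <= b <= mdist x y -> mdist (c a) (c b) = `|a - b|.
Proof. by move=> [iso _ _] ha hb; rewrite iso// in_itv. Qed.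

Lemma geodesic_dist_left x y c a : geodesic_path x y c ->
  0 <= a <= mdist x y -> mdist x (c a) = a.
Proof.
move=> cP ha; have [_ c0 _] := cP.
rewrite -{1}c0 (geodesic_dist cP) ?lexx ?mdist_ge0// sub0r normrN ger0_norm//.
by case/andP: ha.
Qed.

Lemma geodesic_dist_right x y c a : geodesic_path x y c ->
  0 <= a <= mdist x y -> mdist (c a) y = mdist x y - a.
Proof.
move=> cP ha; have [_ _ cd] := cP.
rewrite -{1}cd (geodesic_dist cP) ?lexx ?mdist_ge0// ler0_norm ?opprB//.
by rewrite subr_le0; case/andP: ha.
Qed.

(** Turns the choices behind [seg] and [seg_comb] into evaluation of one geodesic: on its image, the
    distance from x determines the parameter. *)
Lemma seg_comb_geodesic x y : exists2 c, geodesic_path x y c &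
  forall l, 0 <= l <= 1 -> seg_comb S l x y = c (l * mdist x y).
Proof.
have [A [SA _]] := hyperbolic_unique hypX x y.
have [_ [c cP segE]] : S (seg S x y) /\ metric_segment x y (seg S x y).
  by rewrite /seg; apply: (@getPex _ (fun A => S A /\ metric_segment x y A)); exists A.
exists c => // l /andP[l0 l1].
have ld : 0 <= l * mdist x y <= mdist x y.
  by rewrite mulr_ge0 ?mdist_ge0//= ler_piMl// mdist_ge0.
have [] := @xgetPex _ x [set z | [/\ seg S x y z, mdist x z = l * mdist x y
                    & mdist z y = (1 - l) * mdist x y]].
  exists (c (l * mdist x y)); split.
  - by rewrite segE; exists (l * mdist x y) => //=; rewrite in_itv.
  - exact: geodesic_dist_left cP _.
  - by rewrite (geodesic_dist_right cP)// mulrBl mul1r.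
rewrite -/(seg_comb S l x y) segE => -[t /=]; rewrite in_itv/= => t_itv <-.
by rewrite (geodesic_dist_left cP)// => ->.
Qed.

Lemma mdist_seg_comb x y l m : 0 <= l <= 1 -> 0 <= m <= 1 ->
  mdist (seg_comb S l x y) (seg_comb S m x y) = `|l - m| * mdist x y.
Proof.
have [c cP cE] := seg_comb_geodesic x y.
have dom k : 0 <= k <= 1 -> 0 <= k * mdist x y <= mdist x y.
  by move=> /andP[k0 k1]; rewrite mulr_ge0 ?mdist_ge0//= ler_piMl// mdist_ge0.
move=> hl hm; rewrite !cE// (geodesic_dist cP) ?dom//.
by rewrite -mulrBl normrM (ger0_norm (mdist_ge0 x y)).
Qed.

Lemma seg_comb0 x y : seg_comb S 0 x y = x.
Proof.
have [c [_ c0 _] ->] := seg_comb_geodesic x y; last by rewrite lexx ler01.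
by rewrite mul0r.
Qed.

Lemma seg_comb1 x y : seg_comb S 1 x y = y.
Proof.
have [c [_ _ c1] ->] := seg_comb_geodesic x y; last by rewrite lexx ler01.
by rewrite mul1r.
Qed.

Lemma exists_between x y a : 0 <= a <= mdist x y ->
  exists2 z, mdist x z = a & mdist z y = mdist x y - a.
Proof.
move=> ha; have [c cP] := hyperbolic_geodesic hypX x y; exists (c a).
  exact: geodesic_dist_left cP ha.
exact: geodesic_dist_right cP ha.
Qed.

(* Moves y towards w by the length a, stopping at w: the quotient below is
   nonpositive when d(w,y) <= a, and for y = w division by 0 gives l = 0. *)
Definition pull (w : X) (a : R) (y : X) : X :=
  seg_comb S (Num.max 0 ((mdist w y - a) / mdist w y)) w y.

Section Pull.
Variable w : X.

Let pull_coef a y : 0 <= a -> 0 <= Num.max 0 ((mdist w y - a) / mdist w y) <= 1.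
Proof.
move=> a0; rewrite le_max lexx/= ge_max ler01/=.
have [->|d0] := eqVneq (mdist w y) 0; first by rewrite invr0 mulr0.
by rewrite ler_pdivrMr ?mul1r ?gerBl// lt_neqAle eq_sym d0 mdist_ge0.
Qed.

Let pull_coefM a y :
  0 <= a -> Num.max 0 ((mdist w y - a) / mdist w y) * mdist w y = Num.max 0 (mdist w y - a).
Proof.
move=> a0; rewrite maxr_pMl ?mdist_ge0// mul0r.
have [->|d0] := eqVneq (mdist w y) 0.
  by rewrite mulr0 maxxx sub0r max_l// oppr_le0.
by rewrite divfK.
Qed.

Lemma pull_collapse a y : mdist w y <= a -> pull w a y = w.
Proof.
move=> da; rewrite /pull max_l ?seg_comb0//.
by rewrite mulr_le0_ge0 ?subr_le0 ?invr_ge0 ?mdist_ge0.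
Qed.

Lemma mdist_pull_center a y : 0 <= a -> mdist w (pull w a y) = Num.max 0 (mdist w y - a).
Proof.
move=> a0; rewrite -{1}(seg_comb0 w y) /pull mdist_seg_comb ?pull_coef ?lexx ?ler01//.
rewrite sub0r normrN ger0_norm ?pull_coefM//.
by case/andP: (pull_coef y a0).
Qed.

Lemma mdist_pull2 a b y : 0 <= a -> 0 <= b -> mdist (pull w a y) (pull w b y) <= `|a - b|.
Proof.
move=> a0 b0; rewrite /pull mdist_seg_comb ?pull_coef//.
rewrite -[X in _ * X]ger0_norm ?mdist_ge0// -normrM mulrBl !pull_coefM//.
set d := mdist w y; rewrite !maxEle !ler_norml.
have := ler_norm (a - b); have := ler_norm (b - a); rewrite (distrC b a).
case: ifP; case: ifP; lra.
Qed.

Lemma pull0 y : pull w 0 y = y.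
Proof.
have [d0|d0] := eqVneq (mdist w y) 0.
  by rewrite pull_collapse ?d0//; exact: mdist_positivity.
by rewrite /pull subr0 divff// max_r// seg_comb1.
Qed.

Lemma mdist_pull a y : 0 <= a -> mdist y (pull w a y) <= a.
Proof.
move=> a0; rewrite -{1}(pull0 y); apply: le_trans (mdist_pull2 _ _ _) _ => //.
by rewrite sub0r normrN ger0_norm.
Qed.

(* With u = d(w,y) and u' = d(w,y'), the fractions 1 - a/u and 1 - a/u' of
   [w,y] and [w,y'] that are kept satisfy |a/u - a/u'| u' = a|u - u'|/u, which
   compensates the contraction factor 1 - a/u. *)
Lemma pull_nonexpansive a : 0 <= a -> nonexpansive (pull w a).
Proof.
move=> a0 y y'.
have tri z z' : mdist w z <= mdist w z' + mdist z z'.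
  by rewrite (metric_sym z z'); exact: metric_triangle.
have [ya|ya] := leP (mdist w y) a.
  rewrite pull_collapse// mdist_pull_center// ge_max mdist_ge0/=.
  by have := tri y' y; rewrite (metric_sym y' y); lra.
have [ya'|ya'] := leP (mdist w y') a.
  rewrite (pull_collapse ya') metric_sym mdist_pull_center// ge_max mdist_ge0/=.
  by have := tri y y'; lra.
have u0 : 0 < mdist w y by exact: le_lt_trans ya.
have u0' : 0 < mdist w y' by exact: le_lt_trans ya'.
have := pull_coef y a0; have := pull_coef y' a0; rewrite /pull.
have kept z : a < mdist w z -> 0 <= (mdist w z - a) / mdist w z.
  by move=> az; rewrite divr_ge0 ?mdist_ge0// subr_ge0 ltW.
rewrite (max_r (kept y ya)) (max_r (kept y' ya')).
move=> m01 l01.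
apply: le_trans (metric_triangle _ (seg_comb S ((mdist w y - a) / mdist w y) w y') _) _.
apply: le_trans (lerD (hyperbolic_comb hypX w y y' l01) (lexx _)) _.
have norm_u' k : `|k| * mdist w y' = `|k * mdist w y'|.
  by rewrite normrM (ger0_norm (ltW u0')).
rewrite mdist_seg_comb// norm_u'.
have -> : ((mdist w y - a) / mdist w y - (mdist w y' - a) / mdist w y') * mdist w y'
   = a / mdist w y * (mdist w y - mdist w y').
  by field; rewrite !gt_eqF.
have -> : (mdist w y - a) / mdist w y = 1 - a / mdist w y.
  by field; rewrite gt_eqF.
have k0 : 0 <= a / mdist w y by rewrite divr_ge0// ltW.
rewrite normrM (ger0_norm k0) mulrBl mul1r -addrA gerDl addrC subr_le0.
rewrite ler_wpM2l// ler_norml; apply/andP; split.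
  by have := tri y' y; rewrite (metric_sym y' y); lra.
by have := tri y y'; lra.
Qed.

(** Lets the pulled length vary with the point: a length with Lipschitz constant e is compensated by
    values with constant 1 - e. *)
Lemma mdist_pull_le a b y y' : 0 <= a -> 0 <= b ->
  mdist (pull w a y) (pull w b y') <= mdist y y' + `|a - b|.
Proof.
move=> a0 b0; apply: le_trans (metric_triangle _ (pull w a y') _) _.
by apply: lerD; [exact: pull_nonexpansive|exact: mdist_pull2].
Qed.

End Pull.

End Geometry.

(** * Perturbing a nonexpansive map so that it preserves one distance *)

Section Perturbation.
Context {R : realType} {X : metricType R} (S : set (set X)).
Hypotheses (hypX : hyperbolic S) (unbX : unbounded_metric X).
Implicit Types x y z p q w theta : X.

(** Of two points more than 2a apart, one is at distance at least a from x, and the geodesic from x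
    to it meets the sphere. *)
Lemma exists_sphere x a : 0 <= a -> exists y, mdist x y = a.
Proof.
move=> a0; have [y [z yz]] := unbX (2 * a).
have far u : a <= mdist x u -> exists y, mdist x y = a.
  move=> au; have [|v vx _] := exists_between hypX (x := x) (y := u) (a := a).
    by rewrite a0.
  by exists v.
have [|ya] := leP a (mdist x y); first exact: far.
apply: (far z); have := metric_triangle y x z; rewrite (metric_sym y x); lra.
Qed.

(* On the ball where g is constant, g can be replaced by a fold along a
   geodesic of length t. *)
Lemma isometric_bump (g : X -> X) p w t : 0 <= t -> nonexpansive g ->
  (forall x, mdist p x <= t -> g x = w) ->
  exists (h : X -> X) q, [/\ nonexpansive h,
    forall x, t < mdist p x -> h x = g x,
    forall x, mdist p x <= t -> mdist w (h x) <= t,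
    mdist p q = t & mdist (h p) (h q) = t].
Proof.
move=> t0 gN gw.
have [v wv] := exists_sphere w t0; have [q pq] := exists_sphere p t0.
have [c cP] := hyperbolic_geodesic hypX w v; have [_ c0 _] := cP.
(* The fold sends p to v and the sphere of radius t to w, where it agrees with g. *)
pose h x := if mdist p x <= t then c (t - mdist p x) else g x.
have h_in x : mdist p x <= t -> h x = c (t - mdist p x) by rewrite /h => ->.
have h_out x : t < mdist p x -> h x = g x by rewrite /h ltNge => /negbTE ->.
have dom x : mdist p x <= t -> 0 <= t - mdist p x <= mdist w v.
  by have := mdist_ge0 p x; rewrite wv => ? ?; apply/andP; split; lra.
have wh x : mdist p x <= t -> mdist w (h x) = t - mdist p x.
  by move=> xt; rewrite h_in// (geodesic_dist_left cP)// dom.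
(* The geodesic from p to y leaves the ball at a point z with g z = w. Across the sphere, the path
   through w then costs at most d(p,y) - d(p,x) <= d(x,y). *)
have gwD y : t < mdist p y -> mdist w (g y) <= mdist p y - t.
  move=> ty; have [|z pz zy] := exists_between hypX (x := p) (y := y) (a := t).
    by rewrite t0 ltW.
  by rewrite -(gw z) ?pz// -zy; exact: gN.
have tri x y : mdist p y <= mdist p x + mdist x y by exact: metric_triangle.
have h_in_out x y : mdist p x <= t -> t < mdist p y -> mdist (h x) (h y) <= mdist x y.
  move=> xt ty; apply: le_trans (metric_triangle _ w _) _.
  rewrite (metric_sym _ w) wh// h_out//.
  have := gwD _ ty; have := tri x y; lra.
exists h, q; split => //.
- move=> x y; have [xt|xt] := leP (mdist p x) t; have [yt|yt] := leP (mdist p y) t.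
  + rewrite !h_in// (geodesic_dist cP) ?dom//.
    have := tri x y; have := tri y x; rewrite (metric_sym y x) => h1 h2.
    by rewrite ler_norml; apply/andP; split; lra.
  + exact: h_in_out.
  + by rewrite metric_sym (metric_sym x); exact: h_in_out.
  + by rewrite !h_out.
- by move=> x xt; rewrite wh//; have := mdist_ge0 p x; lra.
- rewrite !h_in ?mdistxx ?pq// subrr subr0 c0.
  by rewrite metric_sym (geodesic_dist_left cP)// wv t0 lexx.
Qed.

(* Composing f with the contraction towards theta of ratio 1 - e leaves room to
   pull the values towards w = f1 p by an amount that grows at rate e from
   theta and reaches t before the ball of radius t around the distant point p,
   which is therefore collapsed to w. *)
Lemma exists_isometric_perturbation theta (f : X -> X) (t e : R) :
  nonexpansive f -> 0 < t -> 0 < e <= 1 ->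
  exists (g : X -> X) p q, [/\ nonexpansive g,
    forall x, mdist (f x) (g x) <= 3 * e * mdist x theta,
    mdist p q = t, mdist (g p) (g q) = t &
    mdist p theta <= 3 * t / e /\ mdist q theta <= 3 * t / e].
Proof.
move=> fN t0 /andP[e0 e1].
have te0 : 0 < t / e by rewrite divr_gt0.
have tte : t <= t / e by rewrite ler_pdivlMr// ler_piMr// ltW.
have e01 : 0 <= 1 - e <= 1 by apply/andP; split; lra.
(* The ball of radius t around p stays at distance at least t / e from theta, where [a] has reached
   t. *)
have [p thp] : exists p, mdist theta p = t / e + t.
  by apply: exists_sphere; lra.
pose f1 x := f (seg_comb S (1 - e) theta x).
have f1L x y : mdist (f1 x) (f1 y) <= (1 - e) * mdist x y.
  by apply: le_trans (fN _ _) _; exact: hyperbolic_comb.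
have ff1 x : mdist (f x) (f1 x) <= e * mdist theta x.
  apply: le_trans (fN _ _) _; rewrite -{1}(seg_comb1 hypX theta x).
  rewrite (mdist_seg_comb hypX) ?lexx ?ler01//.
  by rewrite (_ : 1 - (1 - e) = e) ?gtr0_norm//; ring.
pose a x := Num.min t (e * mdist theta x).
have a0 x : 0 <= a x by rewrite le_min ltW//= mulr_ge0 ?mdist_ge0// ltW.
have aL x y : `|a x - a y| <= e * mdist x y.
  have L u v : a u - a v <= e * mdist u v.
    have h1 : e * mdist theta u <= e * mdist theta v + e * mdist u v.
      by rewrite -mulrDr ler_pM2l// (metric_sym u v); exact: metric_triangle.
    have h2 : 0 <= e * mdist u v by rewrite mulr_ge0 ?mdist_ge0// ltW.
    rewrite /a !minEle; case: ifP; case: ifP => /idP h3 /idP h4; lra.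
  have h1 := L x y; have := L y x; rewrite (metric_sym y x) => h2.
  by rewrite ler_norml; apply/andP; split; lra.
pose w := f1 p; pose g x := pull S w (a x) (f1 x).
have gN : nonexpansive g.
  move=> x y; apply: le_trans (mdist_pull_le hypX _ _ _ (a0 x) (a0 y)) _.
  by have := f1L x y; have := aL x y; lra.
have fg x : mdist (f x) (g x) <= 2 * e * mdist theta x.
  apply: le_trans (metric_triangle _ (f1 x) _) _.
  have h1 := ff1 x; have h2 := mdist_pull hypX w (f1 x) (a0 x).
  have : a x <= e * mdist theta x by rewrite ge_min lexx orbT.
  by rewrite -/(g x) in h2; lra.
have far x : mdist p x <= t -> t / e <= mdist theta x.
  have := metric_triangle theta x p; rewrite thp (metric_sym x p); lra.
have gw x : mdist p x <= t -> g x = w.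
  move=> px; apply: pull_collapse => //.
  have -> : a x = t.
    by rewrite /a min_l// mulrC -ler_pdivrMr// far.
  apply: le_trans (f1L _ _) (le_trans _ px).
  by rewrite ler_piMl ?mdist_ge0//; lra.
have [h [q [hN hg hw pq hpq]]] := isometric_bump (ltW t0) gN gw.
have te3 : 3 * t / e = 3 * (t / e) by rewrite mulrA.
exists h, p, q; split => //.
- move=> x; rewrite (metric_sym x); have [xt|xt] := leP (mdist p x) t; last first.
    rewrite hg//; have := fg x.
    have : 0 <= e * mdist theta x by rewrite mulr_ge0 ?mdist_ge0// ltW.
    lra.
  (* The bump adds the third e: h x is within t of w, and t <= e d(theta,x) here. *)
  have h1 := hw _ xt; have h2 := fg x; rewrite gw// in h2.
  have h3 : t <= e * mdist theta x by rewrite mulrC -ler_pdivrMr// far.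
  by have := metric_triangle (f x) w (h x); lra.
- rewrite te3 metric_sym thp (metric_sym q); split; first by lra.
  by have := metric_triangle theta p q; rewrite thp pq; lra.
Qed.

End Perturbation.

(** * Criteria for porosity and sigma-porosity *)

Section PorosityCriterion.
Context {R : realType} {M : metricType R}.

(** A ball around y inside [ball x r] and off A misses x, so its radius is at most d(x,y) < r. Thus
    [gamma] lies in [u, r], and a lower bound for phi on this interval suffices. *)
Lemma porous_at_lower_bound (phi : R -> R) (A : set M) (x : M) (c r0 : R) :
  0 < c -> 0 < r0 -> A x ->
  (forall r, 0 < r < r0 -> exists u x', [/\ 0 < u, ball x' u `<=` ball x r `\` A &
    forall v, u <= v <= r -> c * r <= phi v]) ->
  porous_at phi A x.
Proof.
move=> c0 r00 Ax H; rewrite /porous_at limf_einfE.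
apply: (@lt_le_trans _ _ c%:E); first by rewrite lte_fin.
have V0 : (0 : R)^'+ [set r | 0 < r < r0].
  near=> r; apply/andP; split.
    by near: r; exact: nbhs_right_gt.
  by near: r; exact: nbhs_right_lt.
apply: ereal_sup_ge; eexists; first by exists [set r | 0 < r < r0].
apply: le_ereal_inf_tmp => _ [r /= /[dup] r_itv /andP[r_gt0 _] <-].
have [u [x' [u0 sub uphi]]] := H r r_itv.
have gamma_ge : (u%:E <= gamma x r A)%E.
  by apply: ereal_sup_ubound; exists u => //; split=> //; exists x'.
have gamma_le : (gamma x r A <= r%:E)%E.
  apply: ge_ereal_sup => _ [v [v0 [y ysub]] <-]; rewrite lee_fin.
  have [yx _] : (ball x r `\` A) y by apply: ysub; exact: ballxx.
  have : ~ ball y v x by move=> /ysub[].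
  rewrite ballEmdist /= in yx; rewrite ballEmdist /= metric_sym => /negP.
  by rewrite -leNgt => /le_trans; apply; exact: ltW.
move: gamma_ge gamma_le; case: (gamma x r A) => [v||] //=.
rewrite !lee_fin => uv vr; rewrite ler_pdivlMr//.
by apply: uphi; rewrite uv.
Unshelve. all: by end_near. Qed.

(** Sigma-porosity asks for an exact union, so the pieces are cut down to A; hence the assumption on
    all subsets of F i. *)
Lemma sigma_porous_subset (I : countType) (phi : R -> R) (F : I -> set M) (A : set M) :
  A `<=` \bigcup_i F i -> (forall i B, B `<=` F i -> porous phi B) ->
  sigma_porous M phi A.
Proof.
move=> AF FP; exists (fun n => if unpickle n is Some i then A `&` F i else set0).
split=> [n|]; first by case: unpickle => [i|]; [apply: (FP i) => x []|move=> x []].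
apply/seteqP; split => x.
  by move=> /[dup] Ax /AF[i _ Fx]; exists (pickle i); rewrite ?pickleK.
by move=> [n _]; case: unpickle => // i [].
Qed.

End PorosityCriterion.

(** * The countable cover by sets of shrinking maps *)

Section Shrinking.
Context {R : realType} {X : metricType R}.

Definition shrinking (t t' : R) : set (nonexp X) :=
  [set f | forall x y, mdist x y <= t -> mdist (sval f x) (sval f y) <= t'].

(** The conditions on the rationals sit inside the set, so that all of [rat * rat] can be the index
    type: a bad pair gives the empty set. *)
Definition shrinking_rat (i : rat * rat) : set (nonexp X) :=
  [set f | [/\ 0 < i.1, i.2 < i.1 & shrinking (ratr i.1) (ratr i.2) f]].

Lemma sub_shrinking_rat (i : rat * rat) (B : set (nonexp X)) :
  B `<=` shrinking_rat i -> B !=set0 ->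
  [/\ (0 : R) < ratr i.1, (ratr i.2 : R) < ratr i.1 &
      B `<=` shrinking (ratr i.1) (ratr i.2)].
Proof.
move=> BF [f /BF[i0 i12 _]].
by rewrite ltr0q ltr_rat; split => // g /BF[].
Qed.

(** Moving each of two points at distance t by less than (t - t') / 2 leaves them more than t'
    apart. *)
Lemma not_shrinking (t t' : R) (g h : nonexp X) p q :
  mdist p q = t -> mdist (sval g p) (sval g q) = t ->
  mdist (sval g p) (sval h p) < (t - t') / 2 ->
  mdist (sval g q) (sval h q) < (t - t') / 2 -> ~ shrinking t t' h.
Proof.
move=> pq gpq ghp ghq /(_ p q); rewrite pq lexx => /(_ isT) hpq.
have := metric_triangle (sval g p) (sval h p) (sval g q).
have := metric_triangle (sval h p) (sval h q) (sval g q).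
rewrite (metric_sym (sval h q)); lra.
Qed.

Lemma modulus_le (f : X -> X) (x0 : X) (t c : R) : 0 <= t ->
  (forall x y, mdist x y <= t -> mdist (f x) (f y) <= c) -> modulus f t <= c.
Proof.
move=> t0 fc; apply: ge_sup.
  by exists (mdist (f x0) (f x0)), x0, x0; rewrite mdistxx.
by move=> _ [x [y [xy ->]]]; exact: fc.
Qed.

Lemma modulus_ub (f : X -> X) (t : R) x y : nonexpansive f ->
  mdist x y <= t -> mdist (f x) (f y) <= modulus f t.
Proof.
move=> fN xy; apply: ub_le_sup; last by exists x, y.
by exists t => _ [u [v [uv ->]]]; exact: le_trans uv.
Qed.

Lemma shrinking_cover (x0 : X) :
  [set f : nonexp X | exists2 t : R, 0 < t & modulus (sval f) t < t] `<=`
  \bigcup_i shrinking_rat i.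
Proof.
move=> f [t t0 ft].
have m0 : 0 <= modulus (sval f) t.
  by rewrite -(mdistxx (sval f x0)) modulus_ub ?mdistxx ?(ltW t0)//; exact: svalP.
(* Rationals omega(t) < q' < q < t: pairs at distance at most q are also within t. *)
have [q] := rat_in_itvoo ft; rewrite in_itv/= => /andP[q1 q2].
have [q'] := rat_in_itvoo q1; rewrite in_itv/= => /andP[q'1 q'2].
exists (q, q') => //=; split.
- by rewrite -(ltr0q R); exact: le_lt_trans q1.
- by rewrite -(ltr_rat R).
- move=> x y xy; apply: le_trans (ltW q'1); apply: modulus_ub; first exact: svalP.
  exact: le_trans (ltW q2).
Qed.

(* At scale 1: pairs at distance at most 1/2 keep it, the others shrink by the
   factor phi (1/2). *)
Lemma rakotch_modulus (x0 : X) (f : X -> X) : rakotch f ->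
  exists2 t : R, 0 < t & modulus f t < t.
Proof.
move=> [phi [phi01 phi_mono phi_lt1 fphi]]; exists 1 => //.
have h0 : (0 : R) < 1 / 2 by lra.
apply: (@le_lt_trans _ _ (Num.max (1 / 2) (phi (1 / 2)))); last first.
  by rewrite gt_max phi_lt1// andbT; lra.
apply: (modulus_le x0) => // x y xy; apply: le_trans (fphi x y) _.
rewrite le_max; have d0 := mdist_ge0 x y; have /andP[p0 p1] := phi01 _ d0.
have [xh|hx] := leP (mdist x y) (1 / 2).
  by apply/orP; left; apply: le_trans xh; rewrite ler_piMl.
apply/orP; right; apply: (@le_trans _ _ (phi (mdist x y))); first by rewrite ler_piMr.
by apply: phi_mono; exact: ltW.
Qed.

End Shrinking.

(** * Porosity for the weighted supremum metric *)

Section PorosityS.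
Context {R : realType} {X : metricType R} (theta : X).

(** The weight absorbs the linear growth: a <= 1 + a^s for a >= 0 and s >= 1. *)
Lemma dist_s_le (s e : R) (f g : nonexp X) : 1 <= s -> 0 <= e ->
  (forall x, mdist (sval f x) (sval g x) <= e * mdist x theta) ->
  dist_s theta s f g <= e.
Proof.
move=> s1 e0 fg; apply: sup_img_le => [|x _]; first by exists theta.
rewrite ler_pdivrMr ?ltr_pwDl ?powR_ge0//.
apply: le_trans (fg x) _; rewrite ler_wpM2l//.
have [h|/ltW h] := leP (mdist x theta) 1.
  by rewrite (le_trans h)// lerDl powR_ge0.
by rewrite (le_trans (le1r_powR h s1))// lerDr.
Qed.

Lemma porous_shrinking_s (S : set (set X)) (s : R) (s1 : 1 <= s) (t t' : R)
    (A : set (nonexp X)) :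
  hyperbolic S -> unbounded_metric X -> 0 < t -> t' < t -> A `<=` shrinking t t' ->
  porous (M := nonexp_s theta s1) (fun v => v `^ s^-1) A.
Proof.
move=> hypX unbX t0 tt' At f Af.
(* Within 3t/e of theta, a map at distance less than k e^s from G differs from it by less than k
   (e^s + (3t)^s) <= (t - t') / 2. The bound k <= 1 gives k e^s <= e, so with r = 4e the ball around
   G fits: 3e + e = r. *)
pose k := Num.min 1 ((t - t') / 2 / (1 + (3 * t) `^ s)).
have den0 : 0 < 1 + (3 * t) `^ s by rewrite ltr_pwDl ?powR_ge0.
have k0 : 0 < k by rewrite lt_min ltr01/= divr_gt0//; lra.
have s0 : 0 < s := (lt_le_trans ltr01 s1).
apply: (@porous_at_lower_bound _ _ _ _ _ (k `^ s^-1 / 4) 1) => //.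
  by rewrite divr_gt0 ?powR_gt0.
move=> r /andP[r0 r1]; pose e := r / 4.
have e0 : 0 < e by rewrite /e; lra.
have e1 : e <= 1 by rewrite /e; lra.
have e01 : 0 < e <= 1 by rewrite e0.
have [g [p [q [gN fg pq gpq [pt qt]]]]] :=
  exists_isometric_perturbation hypX unbX theta (svalP f) t0 e01.
have es0 : 0 < e `^ s by rewrite powR_gt0.
pose G : nonexp X := exist _ g gN.
have fG : dist_s theta s f G <= 3 * e by apply: dist_s_le => //; lra.
exists (k * e `^ s), G; split.
- exact: mulr_gt0.
- move=> h; rewrite ballEmdist => /= Gh; split.
    rewrite ballEmdist /=.
    apply: le_lt_trans (dist_s_triangle theta s1 G f h) _.
    have : k * e `^ s <= e.
      apply: (@le_trans _ _ (e `^ s)); last exact: ge1r_powR.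
      by rewrite ler_piMl ?(ltW es0)// ge_min lexx.
    have {}Gh : dist_s theta s G h < k * e `^ s := Gh.
    have -> : r = 4 * e by rewrite /e; field.
    lra.
  have close x : mdist x theta <= 3 * t / e ->
      mdist (sval G x) (sval h x) < (t - t') / 2.
    move=> xt; have := le_lt_trans (dist_s_ub theta s1 G h x) Gh.
    rewrite ltr_pdivrMr ?ltr_pwDl ?powR_ge0// => /lt_le_trans; apply.
    apply: (@le_trans _ _ (k * (1 + (3 * t) `^ s))); last first.
      by rewrite -ler_pdivlMr// ge_min lexx orbT.
    rewrite -mulrA ler_pM2l// mulrDr mulr1 lerD//.
      exact: le_trans (ge1r_powR e01 s1) e1.
    rewrite -powRM ?mdist_ge0 ?(ltW e0)//; apply: ge0_ler_powR.
    - exact: ltW.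
    - by rewrite nnegrE; apply: mulr_ge0; [exact: ltW|exact: mdist_ge0].
    - by rewrite nnegrE mulr_ge0// ltW.
    - by rewrite mulrC -ler_pdivlMr.
  by move=> /At; apply: (not_shrinking (g := G) pq gpq); exact: close.
- move=> v /andP[uv _].
  apply: (@le_trans _ _ ((k * e `^ s) `^ s^-1)).
    rewrite powRM ?(ltW k0) ?(ltW es0)// -powRrM divff ?gt_eqF// powRr1 ?(ltW e0)//.
    by rewrite /e mulrAC mulrA.
  have u0 : 0 < k * e `^ s by exact: mulr_gt0.
  apply: ge0_ler_powR; rewrite ?nnegrE ?invr_ge0 ?(ltW s0) ?(ltW u0)//.
  exact: le_trans (ltW u0) uv.
Qed.

End PorosityS.

(** * Porosity for the series metric *)

Section PorosityPhi.
Context {R : realType} {X : metricType R} (theta : X).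
Variables (I : set R) (phi : R -> R).
Hypothesis adm : admissible I phi.

Lemma adm_gt0 t : I t -> 0 < t.
Proof. by case: (adm_dom adm) => ->; rewrite /= in_itv/= => /andP[]. Qed.

Lemma adm_down t u : I u -> 0 < t -> t <= u -> I t.
Proof.
case: (adm_dom adm) => ->; rewrite /= !in_itv/= => /andP[_ u1] -> tu /=.
  exact: le_lt_trans u1.
exact: le_trans u1.
Qed.

Lemma pinv_admK n : phi (pinv I phi n.+1%:R^-1) = n.+1%:R^-1.
Proof.
apply: pinvK; rewrite inE; have [|t It <-] := adm_surj adm (y := n.+1%:R^-1).
  by rewrite invr_gt0 ltr0n/= invf_le1 ?ltr0n// ler1n.
by exists t.
Qed.

Lemma adm_le t u : I t -> I u -> t <= u -> phi t <= phi u.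
Proof.
move=> It Iu; rewrite le_eqVlt => /predU1P[->//|tu].
by apply/ltW/(adm_mono adm); rewrite ?inE.
Qed.

(* Concavity between c u / 2 and u, where phi is positive at the left end. *)
Lemma adm_scale : exists2 eta, I eta & forall c u, 0 < c <= 1 -> 0 < u < eta ->
  c / 2 * phi u <= phi (c * u).
Proof.
have [eta [Ieta conc _]] := adm_concave adm; exists eta => // c u /andP[c0 c1] /andP[u0 ueta].
pose l := c / (2 - c).
have c2 : 0 < 2 - c by lra.
have l0 : 0 <= l by rewrite divr_ge0// ltW.
have l1 : l <= 1 by rewrite ler_pdivrMr//; lra.
have cl : c / 2 <= l by rewrite ler_pM2l// lef_pV2 ?posrE//; lra.
have cu0 : 0 < c * u by exact: mulr_gt0.
have cuu : c * u <= u by rewrite ler_piMl// ltW.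
have Iu : I u by apply: (adm_down Ieta) => //; exact: ltW.
have Icu : I (c * u / 2) by apply: (adm_down Iu); lra.
have : - phi (l * u + (1 - l) * (c * u / 2)) <= l * - phi u + (1 - l) * - phi (c * u / 2).
  apply: (conc (Itv01 l0 l1)); rewrite inE /= in_itv/= ?u0 ?ueta//.
  by apply/andP; split; lra.
have -> : l * u + (1 - l) * (c * u / 2) = c * u by rewrite /l; field; lra.
rewrite !mulrN -opprD lerN2; apply: le_trans.
have := adm_pos adm Iu; have := adm_pos adm Icu => p1 p2.
apply: (@le_trans _ _ (l * phi u)); first by rewrite ler_pM2r.
by rewrite lerDl mulr_ge0 ?subr_ge0// ltW.
Qed.

Let C := limn (series (fun n => n.+1%:R * pinv I phi n.+1%:R^-1)).

Let weight_ge0 n : 0 <= n.+1%:R * pinv I phi n.+1%:R^-1.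
Proof. by rewrite mulr_ge0// ltW// pinv_adm. Qed.

Lemma series_le_limn (u : nat -> R) n : (forall k, 0 <= u k) ->
  cvgn (series u) -> series u n <= limn (series u).
Proof.
move=> u0 cu; apply: nondecreasing_cvgn_le => //.
by apply/nondecreasing_seqP => k; rewrite /series/= big_nat_recr//= lerDl.
Qed.

Lemma term_le_limn (u : nat -> R) n : (forall k, 0 <= u k) ->
  cvgn (series u) -> u n <= limn (series u).
Proof.
move=> u0 cu; apply: le_trans (series_le_limn n.+1 u0 cu).
by rewrite /series/= big_nat_recr//= lerDr; exact: sumr_ge0.
Qed.

(** A single term is at most the sum; this makes the excluded radius O(e). *)
Lemma pinv_le n : n.+1%:R * pinv I phi n.+1%:R^-1 <= C.
Proof. exact: (term_le_limn n weight_ge0 (adm_inv_summable adm)). Qed.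

Lemma weight_sum_gt0 : 0 < C.
Proof. by apply: lt_le_trans (pinv_le 0); rewrite mulr_gt0// pinv_adm. Qed.

Let term (f g : nonexp X) (n : nat) := pinv I phi n.+1%:R^-1 *
  (dist_ball theta n.+1 f g / (1 + dist_ball theta n.+1 f g)).

Let term_ge0 f g n : 0 <= term f g n.
Proof.
have d0 := dist_ball_ge0 theta n.+1 f g.
by rewrite mulr_ge0 ?(ltW (pinv_adm adm _))// divr_ge0// addr_ge0.
Qed.

Let term_le f g n : term f g n <=
  pinv I phi n.+1%:R^-1 * Num.min 1 (dist_ball theta n.+1 f g).
Proof.
have d0 := dist_ball_ge0 theta n.+1 f g.
rewrite ler_pM2l ?pinv_adm// le_min.
rewrite !ler_pdivrMr ?ltr_pwDl// mul1r lerDr ler01 /=.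
by rewrite ler_peMr// lerDl.
Qed.

Let term_cvg f g : cvgn (series (term f g)).
Proof.
apply: series_le_cvg (adm_inv_summable adm) => // n.
apply: le_trans (term_le _ _ _) _; rewrite mulrC ler_pM2r ?pinv_adm//.
by rewrite ge_min ler1n.
Qed.

(** On the ball of radius n the maps differ by at most e n, which the factor n in the summability
    condition absorbs. *)
Lemma dist_phi_le (f g : nonexp X) (e : R) :
  (forall x, mdist (sval f x) (sval g x) <= e * mdist x theta) -> 0 <= e ->
  dist_phi I phi theta f g <= e * C.
Proof.
move=> fg e0; apply: limr_le; first exact: term_cvg.
near=> N; apply: (@le_trans _ _ (e * series (fun n => n.+1%:R * pinv I phi n.+1%:R^-1) N)).
  rewrite /series /= mulr_sumr; apply: ler_sum => n _.
  apply: le_trans (term_le _ _ _) _; rewrite mulrA [leRHS]mulrC ler_pM2l ?pinv_adm//.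
  rewrite ge_min; apply/orP; right; apply: sup_img_le.
    by exists theta => /=; rewrite mdistxx.
  by move=> x /= xn; apply: le_trans (fg x) _; rewrite ler_wpM2l.
by rewrite ler_wpM2l//; exact: (series_le_limn N weight_ge0 (adm_inv_summable adm)).
Unshelve. all: by end_near. Qed.

(** One term of the series is already below the bound, and a / (1 + a) is increasing. *)
Lemma dist_phi_lt (f g : nonexp X) (d : R) n x : 0 < d ->
  dist_phi I phi theta f g < d / (1 + d) * pinv I phi n.+1%:R^-1 ->
  mdist x theta <= n.+1%:R -> mdist (sval f x) (sval g x) < d.
Proof.
move=> d0 fgd xn; apply: le_lt_trans (dist_ball_ub f g xn) _.
have := le_lt_trans (term_le_limn n (term_ge0 f g) (term_cvg (f := f) (g := g))) fgd.
rewrite /term mulrC ltr_pM2r ?pinv_adm//; have b0 := dist_ball_ge0 theta n.+1 f g.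
rewrite ltr_pdivrMr ?ltr_pwDl// mulrAC ltr_pdivlMr ?ltr_pwDl ?(ltW d0)//.
by rewrite !mulrDr !mulr1 mulrC ltrD2r.
Qed.

Lemma porous_shrinking_phi (S : set (set X)) (t t' : R) (A : set (nonexp X)) :
  hyperbolic S -> unbounded_metric X -> 0 < t -> t' < t -> A `<=` shrinking t t' ->
  porous (M := nonexp_phi theta adm) phi A.
Proof.
move=> hypX unbX t0 tt' At f Af.
have [eta Ieta scale] := adm_scale; have eta0 := adm_gt0 Ieta.
have C0 := weight_sum_gt0.
pose d := (t - t') / 2; have d0 : 0 < d by rewrite /d; lra.
pose tau := d / (1 + d); have tau0 : 0 < tau by rewrite divr_gt0//; lra.
have tau1 : tau <= 1 by rewrite ler_pdivrMr; lra.
(* [K1 * e] will bound the radius w, and [3 * C * e] the distance from f to G; they add up to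
   [K * e = r]. *)
pose K1 := C / (3 * t); have K10 : 0 < K1 by rewrite divr_gt0//; lra.
pose K := 3 * C + K1; have K0 : 0 < K by rewrite /K; lra.
(* The bounds on r: r < K gives e <= 1, r < eta keeps v in I, and r < eta K / K1 puts w below eta,
   where phi is concave. *)
apply: (@porous_at_lower_bound _ _ _ _ _ (tau / 2 / (3 * t + 1) / K)
  (Num.min K (eta * Num.min 1 (K / K1)))) => //.
- by rewrite !divr_gt0//; lra.
- by rewrite lt_min K0 mulr_gt0// lt_min ltr01 divr_gt0.
move=> r /andP[r0]; rewrite lt_min minr_pMr ?(ltW eta0)// lt_min mulr1 => /and3P[rK reta rK1].
pose e := r / K; have e0 : 0 < e by rewrite divr_gt0.
have e1 : e <= 1 by rewrite ler_pdivrMr// mul1r ltW.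
have e01 : 0 < e <= 1 by rewrite e0.
have rE : r = e * K by rewrite divfK// gt_eqF.
have [g [p [q [gN fg pq gpq [pt qt]]]]] :=
  exists_isometric_perturbation hypX unbX theta (svalP f) t0 e01.
pose G : nonexp X := exist _ g gN.
have fG : dist_phi I phi theta f G <= 3 * e * C by apply: dist_phi_le => //; lra.
pose D := 3 * t / e; have D0 : 0 < D by rewrite divr_gt0//; lra.
(* The ball of radius n + 1 contains p and q, while e (n + 1) <= 3t + e <= 3t + 1 keeps 1 / (n + 1)
   of order e. *)
have [n /andP[nD Dn]] : exists n, n%:R <= D < n.+1%:R.
  by exists (Num.truncn D); rewrite truncn_itv// ltW.
pose w := pinv I phi n.+1%:R^-1; have w0 : 0 < w by exact: pinv_adm.
have we : w <= K1 * e.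
  have -> : K1 * e = C / D by rewrite /K1 /D; field; lra.
  rewrite ler_pdivlMr//; apply: le_trans (pinv_le n).
  by rewrite mulrC ler_pM2r// ltW.
have weta : w < eta.
  apply: le_lt_trans we _; rewrite /e mulrA ltr_pdivrMr// mulrC.
  by rewrite -ltr_pdivlMr// -mulrA.
have tw : tau * w <= w by rewrite ler_piMl// ltW.
have tw0 : 0 < tau * w by exact: mulr_gt0.
exists (tau * w), G; split => //.
- move=> h; rewrite ballEmdist => /= Gh.
  have {}Gh : dist_phi I phi theta G h < tau * w := Gh; split.
    rewrite ballEmdist /=.
    apply: le_lt_trans (dist_phi_triangle theta adm G f h) _.
    rewrite rE /K; lra.
  have close x : mdist x theta <= D -> mdist (sval G x) (sval h x) < d.
    by move=> xD; apply: dist_phi_lt Gh _ => //; apply: le_trans xD (ltW Dn).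
  by move=> /At; apply: (not_shrinking (g := G) pq gpq); exact: close.
- move=> v /andP[uv vr].
  have Iv : I v by apply: (adm_down Ieta); [exact: lt_le_trans uv|apply: le_trans vr (ltW reta)].
  apply: le_trans (adm_le (adm_down Iv tw0 uv) Iv uv).
  have tau01 : 0 < tau <= 1 by rewrite tau0.
  have w_itv : 0 < w < eta by rewrite w0.
  (* Here phi w = 1 / (n + 1), and passing from w to tau w costs the factor tau / 2. *)
  apply: le_trans (scale _ _ tau01 w_itv); rewrite pinv_admK.
  have -> : tau / 2 / (3 * t + 1) / K * r = tau / 2 * (e / (3 * t + 1)).
    by rewrite /e; field; lra.
  rewrite ler_pM2l; last by lra.
  rewrite -[leRHS]mul1r ler_pdivlMr ?ltr0n// mulrAC ler_pdivrMr; last by lra.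
  rewrite mul1r; have : e * D = 3 * t by rewrite /D mulrC divfK// gt_eqF.
  have : e * n%:R <= e * D by rewrite ler_pM2l.
  by rewrite -(natr1 n) mulrDr mulr1; lra.
Qed.

End PorosityPhi.

Theorem corollary3p11 (R : realType) (X : metricType R) (S : set (set X))
    (hypX : hyperbolic S) (cplX : complete_metric X)
    (unbX : unbounded_metric X) (theta : X)
    (I : set R) (phi : R -> R) (adm : admissible I phi)
    (s : R) (s1 : 1 <= s) :
  (sigma_porous (nonexp_phi theta adm) phi
     [set f : nonexp X | exists2 t : R, 0 < t & modulus (sval f) t < t] /\
   sigma_porous (nonexp_s theta s1) (fun t => t `^ s^-1)
     [set f : nonexp X | exists2 t : R, 0 < t & modulus (sval f) t < t]) /\
  (sigma_porous (nonexp_phi theta adm) phi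
     [set f : nonexp X | rakotch (sval f)] /\
   sigma_porous (nonexp_s theta s1) (fun t => t `^ s^-1)
     [set f : nonexp X | rakotch (sval f)]).
Proof.
have cover := shrinking_cover theta.
(* Porosity does not pass to subsets by itself, but it is proved for every subset of a piece, so the
   same cover serves the Rakotch contractions. *)
have rakotch_cover := subset_trans (fun f => @rakotch_modulus _ _ theta (sval f)) cover.
have porous_phi i (B : set (nonexp X)) :
    B `<=` shrinking_rat i -> porous (M := nonexp_phi theta adm) phi B.
  move=> BF f Bf; have [i0 i12 Bi] := sub_shrinking_rat BF (ex_intro _ f Bf).
  exact: (porous_shrinking_phi hypX unbX i0 i12 Bi).
have porous_s i (B : set (nonexp X)) : B `<=` shrinking_rat i ->
    porous (M := nonexp_s theta s1) (fun t => t `^ s^-1) B.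
  move=> BF f Bf; have [i0 i12 Bi] := sub_shrinking_rat BF (ex_intro _ f Bf).
  exact: (porous_shrinking_s hypX unbX i0 i12 Bi).
have sigma_phi := @sigma_porous_subset _ (nonexp_phi theta adm) _ phi shrinking_rat.
have sigma_s := @sigma_porous_subset _ (nonexp_s theta s1) _
  (fun v => v `^ s^-1) shrinking_rat.
by split; split; [exact: (sigma_phi _ cover porous_phi)
  |exact: (sigma_s _ cover porous_s)
  |exact: (sigma_phi _ rakotch_cover porous_phi)
  |exact: (sigma_s _ rakotch_cover porous_s)].
Qed.
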